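(* Let $\chi(\{1,2\})$ denote the least number $k$ such that the points of the Euclidean plane $\mathbb{R}^2$ can be colored with $k$ colors so that no two points of the same color are at Euclidean distance exactly $1$ or exactly $2$ from each other. Then $\chi(\{1,2\}) \ge 6$. Equivalently, for every coloring of the points of $\mathbb{R}^2$ with five colors, there exist two points of the same color whose distance is either $1$ or $2$. *)

(* Defs.v *)
From mathcomp Require Import all_boot all_order all_algebra.
From mathcomp Require Import boolp classical_sets reals.
From mathcomp Require Import zify ring lra.
Set Implicit Arguments.
Unset Strict Implicit.
Unset Printing Implicit Defensive.
Import Order.TTheory GRing.Theory Num.Theory.
Local Open Scope classical_set_scope.
Local Open Scope ring_scope.

(* MathComp-Analysis norms 'rV[R]_2 by the maximum of the coordinates, so the
   Euclidean distance has to be written out. *)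
Definition eudist (R : realType) (p q : 'rV[R]_2) : R :=
  Num.sqrt (\sum_i (p 0 i - q 0 i) ^+ 2).

Definition avoids (R : realType) (D : set R) (C : Type) (c : 'rV[R]_2 -> C) :=
  forall p q : 'rV[R]_2, c p = c q -> ~ D (eudist p q).

Definition plane_colorable (R : realType) (D : set R) (k : nat) : Prop :=
  exists c : 'rV[R]_2 -> 'I_k, avoids D c.

(* The argument h makes the least number of colors exist: it fails to when
   0 is in D, for instance. *)
Definition chi (R : realType) (D : set R)
    (h : exists k, `[< plane_colorable D k >]) : nat :=
  ex_minn h.

Lemma chiP (R : realType) (D : set R)
    (h : exists k, `[< plane_colorable D k >]) :
  plane_colorable D (chi h) /\ forall k, plane_colorable D k -> (chi h <= k)%N.
Proof.
rewrite /chi; case: ex_minnP => m /asboolP Dm min_m; split=> // k Dk.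
exact/min_m/asboolP.
Qed.

(* Two reals whose half-unit cells have indices congruent modulo 6 lie in the
   same cell or at distance more than 2. *)
Lemma cell6 (R : realType) (x y : R) :
  (Num.floor (2 * x) %% 6)%Z = (Num.floor (2 * y) %% 6)%Z ->
  (x - y) ^+ 2 < 1 / 4 \/ 4 < (x - y) ^+ 2.
Proof.
set m := Num.floor _; set n := Num.floor _ => mn.
have /andP[mx xm] := floor_itv (2 * x); have /andP[ny yn] := floor_itv (2 * y).
rewrite -/m -/n !intrD in mx xm ny yn.
have [e|[e|e]] : m = n \/ m + 6 <= n \/ n + 6 <= m by lia.
- by left; rewrite e in mx xm; nra.
- by right; move: e; rewrite -(ler_int R) intrD; nra.
- by right; move: e; rewrite -(ler_int R) intrD; nra.
Qed.

Lemma colorable12 (R : realType) :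
  exists k, `[< plane_colorable [set 1; 2 : R] k >].
Proof.
pose cell (p : 'rV[R]_2) : {ffun 'I_2 -> 'I_6} :=
  [ffun i => inord `|(Num.floor (2 * p 0 i)%R %% 6)%Z|%N].
exists #|{: {ffun 'I_2 -> 'I_6}}|; apply/asboolP.
exists (fun p => enum_rank (cell p)) => p q /enum_rank_inj /ffunP epq.
have sq i : (p 0 i - q 0 i) ^+ 2 < 1 / 4 \/ 4 < (p 0 i - q 0 i) ^+ 2.
  apply: cell6; have := congr1 val (epq i); rewrite !ffunE /= !inordK; lia.
have d0 : 0 <= \sum_i (p 0 i - q 0 i) ^+ 2.
  by apply: sumr_ge0 => i _; apply: sqr_ge0.
suff : eudist p q ^+ 2 < 1 \/ 4 < eudist p q ^+ 2.
  by move=> dpq [] /= e; rewrite e in dpq; lra.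
rewrite /eudist sqr_sqrtr //; move: d0; rewrite !big_ord_recl big_ord0.
set i0 := ord0; set i1 := lift _ _ => _.
have := sqr_ge0 (p 0 i0 - q 0 i0); have := sqr_ge0 (p 0 i1 - q 0 i1).
by case: (sq i0) => ?; case: (sq i1) => ?; lra.
Qed.

(* Main.v *)
(* Let w = e^(i pi/3), fix the angle t with cos t = 5/6, and let f be a
   5-coloring avoiding the distances 1 and 2, restricted to the points
   (a + b w) + (c + d w) e^(i t).

   First, no equilateral triangle of side sqrt 3 is monochromatic.  Rotating a
   segment of length sqrt 3 by t moves its endpoint by exactly 1, which links
   the lattice Z[w] to its rotated copy; 185 of the points above have no
   5-coloring in which the triangle 1, w^2, w^4 is monochromatic.

   Next, on a line of Z[w], points at distance 3 or 4 have different colors: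
   equality would force a monochromatic triangle of side sqrt 3 nearby.  So any
   five consecutive points of the line use all five colors, the coloring of
   the line has period 5, and all points at distance 5 have the same color.
   The isosceles triangle with sides 5, 5 and 1 is then a contradiction. *)

Require Import Defs.
From mathcomp Require Import all_boot all_order all_algebra.
From mathcomp Require Import boolp classical_sets reals.
From Stdlib Require Import ZArith FMapPositive.
From mathcomp Require Import zify ssrZ ring lra.
(* ZArith gives the key N to the scope of binary naturals. *)
Delimit Scope nat_scope with N.
Set Implicit Arguments.
Unset Strict Implicit.
Unset Printing Implicit Defensive.

(** * Refuting colorings by a guided search *)

Fixpoint unit_color (m : seq bool) : option nat :=
  match m with
  | [::] => None
  | true :: m' => if has id m' then None else Some 0
  | false :: m' => omap S (unit_color m')
  end.

Lemma unit_colorP m c d : unit_color m = Some c -> nth false m d -> d = c.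
Proof.
elim: m c d => [|[] m IHm] c d //=.
  case: ifP => // /negbT/hasPn m0 [<-]; case: d => // d /=.
  by case: (ltnP d (size m)) => [/(mem_nth false)/m0/negbTE-> | /(nth_default false)->].
by case: d => // d; case: unit_color IHm => // e IHm [<-] /(IHm _ _ erefl)->.
Qed.

Section Search.

Variable neighbors : positive -> seq positive.
Variable triples : seq (positive * positive * positive).

(* Maps a vertex to the bit mask of the colors still allowed there. *)
Definition domains := PositiveMap.t (seq bool).

Definition dom (D : domains) x :=
  if PositiveMap.find x D is Some m then m else nseq 5 true.

(** The queue [q] collects the vertices whose color has just become forced; [None] reports a
    contradiction, a vertex left without colors. *)
Fixpoint prune c ys (D : domains) q :=
  if ys is y :: ys' then
    let m := dom D y in
    if nth false m c then
      let m' := set_nth false m c false in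
      if has id m' then
        prune c ys' (PositiveMap.add y m' D)
          (if unit_color m' is Some d then (y, d) :: q else q)
      else None
    else prune c ys' D q
  else Some (D, q).

(* When the fuel n runs out, the domains reached so far are returned: they are
   still sound. *)
Fixpoint propagate n D (q : seq (positive * nat)) : option domains :=
  match n, q with
  | n'.+1, (x, c) :: q' =>
    if prune c (neighbors x) D q' is Some (D', q'')
    then propagate n' D' q'' else None
  | _, _ => Some D
  end.

Definition mono (D : domains) t :=
  let: (x, y, z) := t in
  match unit_color (dom D x), unit_color (dom D y), unit_color (dom D z) with
  | Some a, Some b, Some c => eqn a b && eqn b c
  | _, _, _ => false
  end.

(** Every stored mask is invariant under the exchange of [a] and [b]; a vertex outside the map
    allows all five colors, so its mask is invariant too. *)
Definition interchangeable a b (D : domains) :=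
  all (fun e => nth false e.2 a (+) ~~ nth false e.2 b) (PositiveMap.elements D).

Definition only c : seq bool := rcons (nseq c false) true.

Fixpoint thread T (step : nat -> T -> option T) cs k :=
  if cs is c :: cs' then obind (thread step cs') (step c k) else Some k.

(* The colors above [used] have not been distinguished so far.  If [c] is one of
   them and it is interchangeable with [used], exchanging the two reduces the
   case [c] to the case [used]. *)
Definition try_color rec used D x c (k : seq positive) :=
  if ~~ nth false (dom D x) c then Some k
  else if c <= used then
    match propagate 1000 (PositiveMap.add x (only c) D) [:: (x, c)] with
    | None => Some k
    | Some D' => if has (mono D') triples then Some k
                 else rec (maxn used c.+1) D' k
    end
  else if interchangeable used c D then Some k else None.

(* The list [branching] gives, in preorder, the vertices on which the search
   tree branches; the result is the part of the list that was not consumed. *)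
Fixpoint refute n used D (branching : seq positive) : option (seq positive) :=
  match n, branching with
  | n'.+1, x :: branching' =>
    thread (try_color (refute n') used D x) (iota 0 5) branching'
  | _, _ => None
  end.

Definition refuted (init : seq positive) branching :=
  match propagate 1000
    (foldr (fun x => PositiveMap.add x (only 0)) (PositiveMap.empty _) init)
    [seq (x, 0) | x <- init] with
  | None => true
  | Some D => isSome (refute (size branching) 1 D branching)
  end.

(** * Soundness of the search *)

Definition coloring (g : positive -> nat) :=
  [/\ forall x, g x < 5, forall x y, List.In y (neighbors x) -> g x <> g y &
      forall x y z, List.In (x, y, z) triples -> ~ (g x = g y /\ g y = g z)].

Definition compatible g D := forall x, nth false (dom D x) (g x).

Lemma dom_add g D x m : compatible g D -> nth false m (g x) ->
  compatible g (PositiveMap.add x m D).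
Proof.
move=> gD mx y; rewrite /dom; case: (Pos.eq_dec y x) => [->|yx].
  by rewrite PositiveMap.gss.
by rewrite PositiveMap.gso //; apply: gD.
Qed.

(** Only a color other than [g y] is removed at [y], so the mask keeps [g y] and never becomes
    empty. *)
Lemma pruneP g c ys D q :
  (forall y, List.In y ys -> c <> g y) -> compatible g D ->
  (forall x d, List.In (x, d) q -> g x = d) ->
  exists D' q', [/\ prune c ys D q = Some (D', q'), compatible g D' &
    forall x d, List.In (x, d) q' -> g x = d].
Proof.
elim: ys D q => [|y ys IHys] D q ysc gD gq /=; first by exists D, q.
have ysc' z : List.In z ys -> c <> g z by move=> zys; apply: ysc; right.
case: ifP => [mc|_]; last exact: IHys.
set m' := set_nth _ _ _ _.
have m'y : nth false m' (g y).
  rewrite nth_set_nth /=; case: eqP => [gyc|_]; last exact: gD.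
  by case: (ysc y) => //; left.
case: ifP => [_|/negP[]]; last first.
  apply/hasP; exists true => //; rewrite -m'y mem_nth //.
  by rewrite ltnNge; apply: contraL m'y => /(nth_default false)->.
apply: IHys => //; first exact: dom_add.
case u: unit_color => [e|//] x d /= [[<- <-]|/gq//].
exact: unit_colorP u m'y.
Qed.

Lemma propagateP g n D q :
  coloring g -> compatible g D -> (forall x d, List.In (x, d) q -> g x = d) ->
  exists2 D', propagate n D q = Some D' & compatible g D'.
Proof.
move=> [_ gN _]; elim: n D q => [|n IHn] D q gD gq; first by exists D.
case: q gq => [|[x c] q] gq /=; first by exists D.
have gx : g x = c by apply: gq; left.
have [|y d yq|D' [q' [-> gD' gq']]] := @pruneP g c (neighbors x) D q _ gD.
- by move=> y /gN; rewrite gx.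
- by apply: gq; right.
exact: IHn.
Qed.

(** The list that reaches the color [c] stays unspecified: [refuteP] holds for every branching
    list. *)
Lemma threadP T (step : nat -> T -> option T) cs k c :
  isSome (thread step cs k) -> c \in cs -> exists k', isSome (step c k').
Proof.
elim: cs k => // d cs IHcs k /=; rewrite in_cons.
case ds: (step d k) => [k'|//] /= tr /predU1P[->|cs_c]; last exact: IHcs tr _.
by exists k; rewrite ds.
Qed.

Definition swap (a b d : nat) := if d == a then b else if d == b then a else d.

Lemma swap_inj a b : injective (swap a b).
Proof.
move=> d e; rewrite /swap.
by repeat case: eqP => [->|?] //; move=> *; congruence.
Qed.

Lemma coloring_swap g a b :
  a < 5 -> b < 5 -> coloring g -> coloring (swap a b \o g).
Proof.
move=> a5 b5 [g5 gN gT]; split=> [x|x y /gN gxy|x y z /gT gxyz] /=.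
- by rewrite /swap; case: ifP => // _; case: ifP.
- by move/swap_inj.
- by case=> /swap_inj ? /swap_inj ?; case: gxyz.
Qed.

Lemma compatible_swap g a b D : a < 5 -> b < 5 ->
  interchangeable a b D -> compatible g D -> compatible (swap a b \o g) D.
Proof.
move=> a5 b5 iD gD x; move: (gD x).
have -> : nth false (dom D x) (g x) = nth false (dom D x) ((swap a b \o g) x) => //.
have abx : nth false (dom D x) a = nth false (dom D x) b.
  rewrite /dom; case fx: PositiveMap.find => [m|]; last by rewrite !nth_nseq a5 b5.
  have := PositiveMap.elements_correct D x fx; move: iD; rewrite /interchangeable.
  elim: PositiveMap.elements => //= e s IHs /andP[es ss] [ex|]; last exact: IHs.
  by move: es; rewrite ex /=; do 2!case: nth.
by rewrite /= /swap; case: eqP => [->|_] //; case: eqP => [->|].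
Qed.

Lemma nth_only c : nth false (only c) c.
Proof. by rewrite nth_rcons size_nseq ltnn eqxx. Qed.

Lemma refuteS n used D x s :
  refute n.+1 used D (x :: s) =
  thread (try_color (refute n) used D x) (iota 0 5) s.
Proof. by []. Qed.

(** Neither propagation nor a monochromatic triple can close the branch of the color [g x], since
    [g] survives both; so a recursive call closed it, against the induction hypothesis. *)
Lemma refuteP n used D branching g :
  coloring g -> compatible g D -> ~ isSome (refute n used D branching).
Proof.
elim: n used D branching g => // n IHn used D [|x s] g gC gD //.
rewrite refuteS => tr; have [g5 gN gT] := gC.
have gxI h : (forall y, h y < 5) -> h x \in iota 0 5 by move=> h5; rewrite mem_iota h5.
(* A color above [used] is exchanged with [used]. Interchangeability is tested on the masks
   themselves, so the new coloring is still compatible with [D]. *)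
wlog gxu : g gC gD g5 gN gT / g x <= used.
  move=> base; case: (leqP (g x) used) => [|ugx]; first exact: base.
  have u5 : used < 5 by apply: ltn_trans (g5 x).
  have [k] := threadP tr (gxI _ g5).
  rewrite /try_color gD leqNgt ugx /=; case: ifP => // iD _.
  have gC' := coloring_swap u5 (g5 x) gC.
  have [] := gC' => g5' gN' gT'.
  apply: (base _ gC' (compatible_swap u5 (g5 x) iD gD)) => //=.
  by rewrite /swap eqxx; case: eqP => // ->.
have [k] := threadP tr (gxI _ g5).
rewrite /try_color gD gxu.
have [||D' -> gD'] := @propagateP g 1000 (PositiveMap.add x (only (g x)) D) [:: (x, g x)] gC.
- by apply: dom_add => //; apply: nth_only.
- by move=> y d [[<- <-]|[]].
case: ifP => [|_]; last exact: IHn.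
rewrite -[has _ _]negbK => /negP[]; apply/negP.
elim: triples gT => //= -[[y1 y2] y3] ts IHts gT.
case/orP => [|/IHts]; last by apply=> y z w ?; apply: gT; right.
rewrite /mono; case u1: unit_color => [c1|//]; case u2: unit_color => [c2|//].
case u3: unit_color => [c3|//] /andP[/eqnP c12 /eqnP c23].
case: (gT y1 y2 y3); first by left.
by rewrite (unit_colorP u1 (gD' y1)) (unit_colorP u2 (gD' y2)) (unit_colorP u3 (gD' y3)).
Qed.

Lemma refutedP init branching g : refuted init branching -> coloring g ->
  ~ (forall x y, List.In x init -> List.In y init -> g x = g y).
Proof.
move=> rf gC gI.
(* The search starts with color 0 on [init]; exchanging 0 with the common color of [init] leads to
   this case. *)
wlog gI0 : g gC {gI} / forall x, List.In x init -> g x = 0.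
  case: init gI rf => [|x0 init] gI _; first by move/(_ g gC); apply.
  have [g5 _ _] := gC.
  move/(_ (swap 0 (g x0) \o g)); apply; first exact: coloring_swap.
  by move=> x xi /=; rewrite (gI x x0) //; [rewrite /swap eqxx; case: eqP|left].
move: rf; rewrite /refuted.
set D := foldr _ _ _; have gD : compatible g D.
  rewrite {}/D; elim: init gI0 => [|x s IHs] gI0 /=.
    by move=> x; rewrite /dom PositiveMap.gempty nth_nseq; case: gC => ->.
  apply: dom_add; first by apply: IHs => y ys; apply: gI0; right.
  by rewrite gI0 //; left.
have [|D' -> gD'] := @propagateP g 1000 D [seq (x, 0) | x <- init] gC gD.
  by move=> x d /List.in_map_iff [y [[<- <-] /gI0]].
exact: refuteP gC gD'.
Qed.

End Search.

(** * The two rotated lattices *)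

(* (a, b, c, d) stands for (a + b w) + (c + d w) e^(i t). *)
Notation vec := (Z * Z * Z * Z)%type.

Definition addv (p q : vec) : vec :=
  let: (a, b, c, d) := p in let: (a', b', c', d') := q in
  (a + a', b + b', c + c', d + d')%Z.

Definition subv (p q : vec) : vec :=
  let: (a, b, c, d) := p in let: (a', b', c', d') := q in
  (a - a', b - b', c - c', d - d')%Z.

(* Multiplication by w, where w^2 = w - 1. *)
Definition rotv (p : vec) : vec :=
  let: (a, b, c, d) := p in (- b, a + b, - d, c + d)%Z.

(* The squared norm has an irrational part proportional to b c - a d; when this
   vanishes, n is three times the squared norm. *)
Definition short (p : vec) : bool :=
  let: (a, b, c, d) := p in
  if (b * c =? a * d)%Z then
    let n := (3 * (a * a + a * b + b * b + c * c + c * d + d * d)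
              + 5 * (a * c + a * d + b * d))%Z in
    (n =? 3)%Z || (n =? 12)%Z
  else false.

Definition proper (f : vec -> 'I_5) :=
  forall p q, short (subv q p) -> f p <> f q.

Definition coords (pts : seq vec) : PositiveMap.t vec :=
  (foldl (fun xm p => (Pos.succ xm.1, PositiveMap.add xm.1 p xm.2))
     (1%positive, PositiveMap.empty vec) pts).2.

(** Total, because [coloring] asks for a color at every [positive]; positions beyond the list stand
    for the origin. *)
Definition coord (cs : PositiveMap.t vec) x :=
  odflt (0, 0, 0, 0)%Z (PositiveMap.find x cs).

Definition indices (pts : seq vec) :=
  [seq Pos.of_succ_nat i | i <- iota 0 (size pts)].

Definition adjacency (cs : PositiveMap.t vec) (xs : seq positive) :=
  foldr (fun x => PositiveMap.add x
    [seq y <- xs | short (subv (coord cs y) (coord cs x))])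
    (PositiveMap.empty _) xs.

Definition adjacent (A : PositiveMap.t (seq positive)) x :=
  odflt [::] (PositiveMap.find x A).

Lemma adjacentP cs xs x y :
  List.In y (adjacent (adjacency cs xs) x) -> short (subv (coord cs y) (coord cs x)).
Proof.
rewrite /adjacency; elim: {2}xs => [|z s IHs] /=.
  by rewrite /adjacent PositiveMap.gempty.
rewrite /adjacent; case: (Pos.eq_dec x z) => [<-|xz].
  rewrite PositiveMap.gss /=; elim: xs {IHs} => //= w t IHt.
  by case: ifP => // sw [<-|].
by rewrite PositiveMap.gso.
Qed.

(* An equilateral triangle of side sqrt 3 in Z[w], in one of its two
   orientations. *)
Definition sqrt3_triangle (p q r : vec) : bool :=
  ((subv q p == (-2, 1, 0, 0)%Z) && (subv r p == (-1, -1, 0, 0)%Z)) ||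
  ((subv q p == (-1, -1, 0, 0)%Z) && (subv r p == (1, -2, 0, 0)%Z)).

Definition refuted_points pts triples init branching :=
  let cs := coords pts in
  let A := adjacency cs (indices pts) in
  all (fun t => sqrt3_triangle (coord cs t.1.1) (coord cs t.1.2) (coord cs t.2)) triples
  && refuted (adjacent A) triples init branching.

Definition triangle_free (f : vec -> 'I_5) :=
  forall p q r, sqrt3_triangle p q r -> ~ (f p = f q /\ f q = f r).

(** The disjunction serves two stages: the search that establishes [triangle_free] has no triples,
    and the later ones build on it. *)
Lemma refuted_pointsP pts triples init branching f :
    refuted_points pts triples init branching -> proper f ->
    triples = [::] \/ triangle_free f ->
  ~ (forall x y, List.In x init -> List.In y init ->
       f (coord (coords pts) x) = f (coord (coords pts) y)).
Proof.
move=> /andP[tT /refutedP rP] fP fT fI.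
apply: (rP (fun x => f (coord (coords pts) x))) => [|x y xi yi]; last by rewrite (fI x y).
split=> [x|x y /adjacentP/fP fxy /val_inj//|x y z xyz [/val_inj fxy /val_inj fyz]].
  exact: ltn_ord.
case: fT => [ts0|fT]; first by move: xyz; rewrite ts0.
suff tt : sqrt3_triangle (coord (coords pts) x) (coord (coords pts) y) (coord (coords pts) z).
  exact: fT tt (conj fxy fyz).
elim: triples tT xyz {rP} => //= t ts IHts /andP[tt tts] [txyz|/(IHts tts)//].
by rewrite txyz in tt.
Qed.

Lemma short_rotv p : short (rotv p) = short p.
Proof.
case: p => [[[a b] c] d]; rewrite /short /rotv.
have -> : ((a + b) * - d =? - b * (c + d))%Z = (b * c =? a * d)%Z by lia.
by case: ifP => // _; congr ((_ =? _)%Z || (_ =? _)%Z); lia.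
Qed.

Lemma proper_addv f o : proper f -> proper (f \o addv o).
Proof.
move=> fP p q pq; apply: fP; move: pq.
case: o p q => [[[? ?] ?] ?] [[[? ?] ?] ?] [[[? ?] ?] ?] /=.
by congr (is_true (short (_, _, _, _))); lia.
Qed.

Lemma proper_rotv f : proper f -> proper (f \o rotv).
Proof.
move=> fP p q pq; apply: fP; move: pq; rewrite -short_rotv.
case: p q => [[[? ?] ?] ?] [[[? ?] ?] ?] /=.
by congr (is_true (short (_, _, _, _))); lia.
Qed.

(* The points and the branching vertices were found by computer search; a vertex
   is the position of its point in the list, counted from 1. *)
Definition triangle_points : seq vec := [::
   (0, 0, 0, 0); (0, 0, -1, 0); (-1, 0, 0, 0); (0, 0, -1, 1); (0, -1, 0, 0);
   (0, 0, 0, -1); (-1, 0, 0, 1); (-1, 0, 1, -1); (0, 1, -1, 0); (1, -1, -1, 0);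
   (-1, 1, 0, -1); (0, 1, 0, 0); (-1, 1, 1, 0); (0, -1, -1, 1); (1, 0, -1, 1);
   (0, 0, 0, 1); (1, 0, 0, -1); (-1, 1, 0, 0); (-1, 0, -1, 1); (-1, 0, 1, 0);
   (1, 0, -1, 0); (-1, 1, 1, -1); (1, -1, -1, 1); (0, -1, 0, 1); (0, -1, 1, 0);
   (0, 1, 0, -1); (1, 0, 0, 0); (0, 0, 1, 0); (1, -1, 0, 1); (-1, 0, 0, -1);
   (-1, 1, -1, 0); (0, -1, -1, 0); (0, 1, -1, 1); (1, -1, 0, 0); (0, 0, 1, -1);
   (0, 1, 1, -1); (-1, 1, 0, 1); (1, -1, 0, -1); (1, 0, 0, 1); (-1, 0, -1, 0);
   (0, -1, 1, -1); (0, 1, 1, 0); (1, 0, 1, -1); (-1, 1, -1, 1); (0, -1, 0, -1);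
   (0, 1, 0, 1); (1, -1, 1, 0); (1, -1, 1, -1); (1, 0, 1, 0); (-2, 0, 0, 0);
   (0, 0, -2, 1); (0, 0, -2, 2); (0, 0, -1, 2); (-2, 1, 0, 0); (-1, -1, 0, 0);
   (0, 0, -1, -1); (-1, 2, 0, 0); (1, -2, 0, 0); (1, 1, 0, 0); (0, 0, 1, 1);
   (-2, 0, 1, 0); (0, 0, -2, 0); (-2, 1, 0, -1); (-2, 2, 0, 0); (-2, 1, 1, -1);
   (-2, 1, 1, 0); (0, -1, -2, 1); (0, 1, -2, 1); (1, -1, -2, 1); (1, 0, -2, 1);
   (0, -1, -2, 2); (-1, -1, -1, 1); (-1, -1, 0, 1); (-1, -1, 1, 0);
   (0, 1, -1, -1); (1, 0, -1, -1); (-1, 2, -1, 0); (-1, 2, 0, -1);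
   (-1, 2, 1, -1); (-1, 0, -1, 2); (0, -1, -1, 2); (0, 0, 1, -2);
   (1, -2, -1, 1); (1, -2, 0, 1); (-1, 1, 1, -2); (0, 0, 2, -1); (1, 1, -1, 0);
   (1, 1, 0, -1); (-1, 0, 1, 1); (0, -1, 1, 1); (-1, 0, 2, -1); (-1, 1, 2, -1);
   (-2, 0, 0, 1); (-2, 0, 1, -1); (0, 1, -2, 0); (1, 0, -2, 0); (-2, 1, 0, 1);
   (-2, 2, 0, -1); (-2, 2, 1, -1); (1, 0, -2, 2); (0, -2, 0, 0);
   (-1, -1, 1, -1); (-1, 1, -1, -1); (1, -1, -1, -1); (0, 2, 0, 0);
   (-1, 2, 1, 0); (1, -1, -1, 2); (1, 0, -1, 2); (0, -2, 0, 1); (0, 2, 0, -1);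
   (1, -2, -1, 0); (2, -2, 0, 0); (-1, 0, 1, -2); (0, 1, 1, -2); (1, 0, 1, -2);
   (2, -1, 0, 0); (2, 0, 0, 0); (0, 0, 2, 0); (1, 1, -1, 1); (1, 1, 1, -1);
   (-1, 1, 1, 1); (2, -2, -1, 1); (2, -1, -1, 0); (2, -1, -1, 1);
   (0, -1, 2, -1); (0, 1, 2, -1); (2, 0, -1, 0); (-1, 0, 2, 0); (-2, 0, 0, -1);
   (1, -1, -2, 0); (-2, 1, -1, 0); (-2, 2, -1, 0); (-2, 2, 1, 0);
   (1, -1, -2, 2); (0, 0, 0, -2); (0, 0, 0, 2); (0, -2, -1, 1); (0, 1, 0, -2);
   (0, 2, -1, 0); (-1, 0, 0, 2); (0, -1, 0, 2); (1, -2, 1, 0); (1, -1, 1, 1);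
   (2, -1, 0, 1); (-1, 1, 2, 0); (0, -1, 2, 0); (-2, 0, -1, 0); (-2, 0, -1, 1);
   (0, -1, -2, 0); (-2, 1, -1, 1); (-1, 0, -2, 1); (-1, 0, -2, 2);
   (-1, -1, -1, 0); (-1, -1, 0, -1); (0, -1, -1, -1); (-1, 2, -1, 1);
   (0, 1, -1, 2); (0, -2, 1, 0); (-1, 1, 0, -2); (1, 0, 0, -2); (0, 2, 1, -1);
   (0, 1, 1, 1); (2, -2, -1, 0); (2, -2, 0, 1); (-1, 1, 2, -2); (2, -1, 0, -1);
   (-1, 1, -2, 1); (0, 1, -2, 2); (-1, 0, -1, -1); (-1, 2, 0, 1);
   (-1, 1, -1, 2); (1, -2, 0, -1); (1, -2, 1, -1); (0, -1, 1, -2);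
   (1, -1, 1, -2); (1, 1, 0, 1); (1, 1, 1, 0); (1, 0, 1, 1); (-1, 0, 2, -2);
   (1, -1, 2, -1); (1, 0, 2, -1); (2, 0, -1, 1); (2, 0, 0, -1); (0, 1, 2, 0);
   (0, 0, -2, 3)]%Z.

Definition triangle_branching : seq positive := [::
   13; 22; 11; 15; 24; 21; 17; 14; 16; 7; 36; 94; 61; 2; 61; 10; 26; 6; 20; 28;
   4; 96; 65; 4; 7; 14; 97; 65; 54; 3; 14; 65; 16; 50; 19; 20; 28; 1; 4; 29;
   70; 14; 97; 56; 16; 50; 14; 65; 65; 6; 28; 4; 76; 75; 41; 4; 28; 1; 3; 61;
   61; 1; 41; 130; 55; 41; 1; 61; 66; 54; 96; 97; 6; 28; 4; 76; 76; 4; 76; 4;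
   28; 41; 66; 3; 95; 61; 4; 8; 41; 61; 32; 1; 61; 66; 96; 97; 90; 36; 45; 37;
   61; 7; 61; 6; 16; 36; 96; 2; 7; 16; 7; 26; 28; 3; 3; 33; 42; 20; 4; 41; 61;
   74; 4; 42; 61; 25; 36; 35; 85; 29; 78; 104; 3; 3; 76; 26; 2; 66; 4; 85; 73;
   26; 56; 56; 56; 76; 2; 3; 23; 135; 6; 17; 8; 3; 3; 36; 41; 2; 2; 29; 93; 74;
   36; 41; 2; 61; 61; 16; 14; 96; 2; 163; 30; 6; 23; 55; 35; 4; 66; 3; 30; 8;
   20; 61; 4; 8; 2; 1; 2; 6; 94; 68; 70; 4; 16; 2; 3; 93; 6; 3; 3; 110; 76; 70;
   6; 93; 17; 93; 70; 6; 2; 70; 151; 36; 76; 61; 4; 6; 2; 70; 9; 6; 93; 70; 23;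
   99; 55; 50; 9; 94; 4; 6; 93; 6; 70; 9; 148; 61; 4; 6; 70; 2; 70; 93; 10; 6;
   93; 17; 65; 70; 21; 26; 93; 2; 57; 6; 9; 19; 17; 93; 4; 6; 94; 8; 1; 93; 93;
   2; 2; 24; 17; 90; 16; 7; 61; 2; 61; 2; 16; 7; 4; 3; 33; 42; 33; 42; 36; 79;
   66; 6; 3; 4; 3; 7; 26; 94; 23; 7; 7; 26; 37; 41; 41; 6; 41; 16; 37; 8; 3; 1;
   16; 16; 41; 3; 7; 61; 37; 20; 65; 14; 6; 35; 161; 90; 4; 26; 6; 20; 14; 42;
   54; 3; 42; 54; 3; 28; 32; 36; 51; 4; 73; 3; 14; 16; 54; 55; 2; 93; 93; 2;
   20; 14; 16; 16; 3; 16; 69; 63; 28; 4; 96; 41; 65; 4; 100; 3; 14; 2; 65; 54;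
   6; 28; 32; 54; 4; 4; 7; 95; 28; 41; 3; 65; 2; 2; 4; 61; 9; 4; 62; 4; 4; 37;
   1; 32; 3; 148; 122; 90; 96; 97; 6; 28; 4; 7; 54; 96; 4; 14; 150; 28; 32; 3;
   23; 4; 66; 54; 51; 54; 56; 1; 41; 95; 41; 74; 113; 8; 4; 23; 4; 2; 14; 25;
   17; 8; 56; 56; 26; 6; 9; 1; 4; 94; 94; 73; 4; 94; 94; 6; 4; 94; 94; 4; 94;
   94; 6; 29; 2; 29; 3; 2; 94; 94; 17; 36; 161; 23; 66; 16; 61; 61; 4; 3; 26;
   6; 28; 23; 65; 2; 54; 68; 2; 150; 3; 61; 150; 6; 35; 7; 61; 61; 35; 61; 50;
   150; 7; 3; 6; 61; 3; 28; 4; 3; 2; 54; 3; 23; 109; 70; 28; 61; 6; 6; 61; 41;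
   36; 2; 61; 6; 6; 17; 8; 93; 93; 10; 26; 6; 2; 4; 93; 93; 66; 3; 4; 3; 10; 6;
   2; 4; 4; 2; 10; 6; 4; 2; 54; 2; 4; 50; 50; 12; 31; 25; 17; 70; 8; 2; 2; 10;
   70; 26; 6; 2; 4; 94; 94; 73; 6; 2; 29; 94; 4; 2; 6; 86; 94; 2; 94; 94; 16;
   7; 2; 2; 2; 2; 17; 8; 2; 2; 26; 6; 2; 8; 3; 8; 3; 4; 6; 1; 28; 94; 4; 94; 6;
   1; 2; 1; 3; 71; 8; 2; 2; 20; 61; 4; 7; 6; 3; 84; 3; 16; 2; 6; 6; 151; 17;
   58; 70; 6; 2; 30; 151; 36; 79; 67; 16; 6; 70; 70; 17; 93; 17; 3; 93; 61; 4;
   6; 70; 2; 70; 69; 9; 55; 6; 93; 17; 9; 70; 21; 26; 99; 2; 93; 7; 6; 6; 64;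
   6; 16; 17; 93; 6; 17; 93; 61; 16; 6; 70; 23; 10; 7; 54; 50; 6; 70; 10; 17;
   3; 78; 10; 16; 6; 94; 7; 6; 17; 78; 94; 25; 29; 17; 26; 6; 28; 23; 65; 65;
   1; 10; 93; 4; 8; 3; 61; 4; 31; 4; 65; 6; 28; 4; 4; 99; 28; 4; 99; 1; 31; 93;
   6; 61; 4; 99; 2; 4; 28; 4; 123; 54; 1; 79; 23; 3; 65; 2; 28; 61; 1; 36; 61;
   41; 36; 61; 41; 8; 48; 6; 70; 16; 26; 79; 61; 36; 61; 35; 61; 61; 61; 29;
   26; 3; 93; 10; 3; 96; 26; 28; 2; 30; 2; 94; 28; 9; 79; 79; 7; 61; 35; 3; 79;
   8; 2; 2; 15; 21; 24; 25; 9; 2; 16; 8; 3; 7; 51; 50; 30; 54; 51; 9; 14; 8; 2;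
   7; 16; 26; 4; 9; 23; 2; 68; 69; 23; 26; 4; 29; 9; 3; 57; 14; 9; 2; 8; 19;
   93; 54; 19; 17; 2; 93; 93; 9; 25; 17; 6; 23; 2; 93; 93; 4; 93; 93; 93; 36;
   4; 4; 2; 93; 93; 7; 3; 3; 81; 9; 14; 2; 93; 93; 8; 96; 16; 23; 1; 2; 49; 2;
   4; 28; 23; 2; 93; 26; 4; 4; 9; 4; 7; 17; 16; 7; 161; 2; 94; 42; 61; 161; 2;
   94; 42; 93; 25; 14; 16; 93; 40; 2; 93; 8; 55; 26; 3; 54; 35; 93; 23; 23; 8;
   2; 2; 94; 94; 14; 2; 93; 93; 7; 4; 23; 1; 1; 23; 9; 50; 3; 28; 30; 2; 23;
   40; 50; 97; 6; 67; 2; 24; 9; 19; 7; 33; 2; 3; 96; 16; 7; 33; 130; 10; 32;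
   20; 2; 2; 2; 28; 40; 9; 9; 4; 94; 33; 95; 160; 39; 25; 20; 93; 79; 9; 9; 93;
   2; 54; 32; 3; 2; 68; 20; 32; 2; 2; 68; 36; 24; 2; 3; 32; 93; 2; 14; 17; 7;
   51; 51; 2; 93; 93; 16; 7; 2; 139; 20; 93; 81; 20; 40; 40; 9; 3; 3; 39; 9; 3;
   3; 52; 32; 3; 2; 2; 40; 20; 52; 7; 52; 81; 9; 2; 20; 53; 51; 16; 16; 151; 7;
   17; 2; 9; 20; 46; 9; 20; 3; 54; 52; 36; 3; 16; 3; 69; 23; 7; 139; 93; 93;
   139; 93; 94; 16; 7; 9; 54; 2; 2; 2; 24; 25; 17; 36; 14; 28; 23; 4; 3; 93;
   23; 3; 3; 35; 55; 4; 3; 20; 9; 2; 93; 93; 2; 93; 93; 70; 7; 2; 2; 7; 2; 2;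
   17; 7; 2; 2; 7; 42; 35; 3; 96; 2; 93; 93; 28; 23; 2; 3; 3; 20; 4; 3; 19; 51;
   65; 3; 4; 3; 20; 7; 14; 70; 25; 7; 26; 93; 26; 93; 93; 2; 93; 93; 2; 93; 93;
   16; 93; 2; 3; 26; 2; 30; 3; 51; 26; 51; 2; 9; 122; 9; 25; 93; 93; 25; 7; 9;
   2; 2; 17; 7; 2; 2; 36; 2; 16; 26; 4; 9; 23; 70; 2; 12; 2; 49; 2; 23; 20; 32;
   4; 2; 49; 65; 94; 65; 94; 94]%positive.

Lemma hexagon_triangle_not_mono f : proper f ->
  ~ (f (1, 0, 0, 0)%Z = f (-1, 1, 0, 0)%Z /\ f (-1, 1, 0, 0)%Z = f (0, -1, 0, 0)%Z).
Proof.
move=> fP [fpq fqr].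
(* 27, 18 and 5 are the positions of 1, w^2 and w^4. *)
have tri : refuted_points triangle_points [::] [:: 27; 18; 5]%positive triangle_branching.
  by vm_compute.
apply: (refuted_pointsP tri fP); first by left.
move=> x y.
have cx z : List.In z [:: 27; 18; 5]%positive ->
    f (coord (coords triangle_points) z) = f (1, 0, 0, 0)%Z.
  by case=> [<-|[<-|[<-|[]]]]; rewrite -?fqr -?fpq; congr f; vm_compute.
by move=> /cx-> /cx->.
Qed.

(** Translation by [p] - 1 takes 1, w^2, w^4 to a triangle of the first orientation. For the second,
    multiplication by w gives w, w^3, w^5, followed by the translation by [p] - w. *)
Lemma proper_triangle_free f : proper f -> triangle_free f.
Proof.
move=> fP p q r /orP[]/andP[/eqP qp /eqP rp].
- have := hexagon_triangle_not_mono (proper_addv (o := subv p (1, 0, 0, 0)%Z) fP).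
  move: qp rp; case: p q r => [[[? ?] ?] ?] [[[? ?] ?] ?] [[[? ?] ?] ?] /=.
  move=> [? ? ? ?] [? ? ? ?]; congr (~ (f (_, _, _, _) = f (_, _, _, _) /\
    f (_, _, _, _) = f (_, _, _, _))); lia.
- have := hexagon_triangle_not_mono (proper_rotv (proper_addv (o := subv p (0, 1, 0, 0)%Z) fP)).
  move: qp rp; case: p q r => [[[? ?] ?] ?] [[[? ?] ?] ?] [[[? ?] ?] ?] /=.
  move=> [? ? ? ?] [? ? ? ?]; congr (~ (f (_, _, _, _) = f (_, _, _, _) /\
    f (_, _, _, _) = f (_, _, _, _))); lia.
Qed.

(** * Colors along a line of Z[w] *)

Definition row3_points : seq vec := [::
   (0, 0, 0, 0); (0, 1, 0, 0); (0, 2, 0, 0); (1, -1, 0, 0); (1, 0, 0, 0);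
   (1, 1, 0, 0); (1, 2, 0, 0); (2, -2, 0, 0); (2, -1, 0, 0); (2, 0, 0, 0);
   (2, 1, 0, 0); (3, -2, 0, 0); (3, -1, 0, 0); (3, 0, 0, 0)]%Z.

Definition row3_triples : seq (positive * positive * positive) := [::
   (6, 1, 9); (7, 2, 10); (10, 2, 4); (10, 4, 12); (11, 3, 5); (11, 5, 13);
   (13, 5, 8); (14, 6, 9)]%positive.

Definition row3_branching : seq positive := [:: 5; 10; 6; 9; 4; 12; 2; 7]%positive.

Definition row4_points : seq vec := [::
   (0, 0, 0, 0); (0, 1, 0, 0); (0, 2, 0, 0); (1, -1, 0, 0); (1, 0, 0, 0);
   (1, 1, 0, 0); (1, 2, 0, 0); (2, -2, 0, 0); (2, -1, 0, 0); (2, 0, 0, 0);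
   (2, 1, 0, 0); (2, 2, 0, 0); (3, -2, 0, 0); (3, -1, 0, 0); (3, 0, 0, 0);
   (3, 1, 0, 0); (4, -2, 0, 0); (4, -1, 0, 0); (4, 0, 0, 0)]%Z.

Definition row4_triples : seq (positive * positive * positive) := [::
   (6, 1, 9); (7, 2, 10); (10, 2, 4); (10, 4, 13); (11, 3, 5); (11, 5, 14);
   (12, 6, 15); (14, 5, 8); (15, 6, 9); (15, 9, 17); (16, 7, 10); (16, 10, 18);
   (18, 10, 13); (19, 11, 14)]%positive.

Definition row4_branching : seq positive := [::
   10; 5; 6; 9; 11; 14; 9; 14; 11; 15; 11; 14]%positive.

Definition row (k : Z) : vec := (k, 0, 0, 0)%Z.

(** Distances 1 and 2 are forbidden outright. For 3 and 4, the search gives both ends of a segment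
    from 0 (positions 1 and 14, or 1 and 19) the same color and excludes monochromatic triangles
    around it. *)
Lemma row_neq f k d : proper f -> (d = 1 \/ d = 2 \/ d = 3 \/ d = 4)%Z ->
  f (row k) <> f (row (k + d)%Z).
Proof.
move=> fP dP.
wlog -> : f fP k / k = 0%Z.
  have gP := proper_addv (o := row k) fP.
  by move=> /(_ _ gP 0%Z erefl); rewrite /= !Z.add_0_r.
have fT := proper_triangle_free fP.
case: dP => [->|[->|[->|->]]] /=; [exact: fP | exact: fP | |] => f0.
- have tri : refuted_points row3_points row3_triples [:: 1; 14]%positive row3_branching.
    by vm_compute.
  apply: (refuted_pointsP tri fP); first by right.
  by move=> x y /= [<-|[<-|[]]] [<-|[<-|[]]]; rewrite // f0.
- have tri : refuted_points row4_points row4_triples [:: 1; 19]%positive row4_branching.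
    by vm_compute.
  apply: (refuted_pointsP tri fP); first by right.
  by move=> x y /= [<-|[<-|[]]] [<-|[<-|[]]]; rewrite // f0.
Qed.

(** The points 1 to 4 have four different colors, which 0 and 5 both avoid; different colors at 0
    and 5 would make six. *)
Lemma row5 f : proper f -> f (row 0) = f (row 5).
Proof.
move=> fP.
have N k d := @row_neq f k d fP.
pose s := [:: f (row 1); f (row 2); f (row 3); f (row 4)].
have s_uniq : uniq s.
  rewrite /s /= !inE !negb_or.
  by do !(apply/andP; split) => //; apply/eqP; [apply: (N 1%Z 1%Z)|apply: (N 1%Z 2%Z)|
    apply: (N 1%Z 3%Z)|apply: (N 2%Z 1%Z)|apply: (N 2%Z 2%Z)|apply: (N 3%Z 1%Z)]; lia.
have s0 : f (row 0) \notin s.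
  rewrite !inE !negb_or; do !(apply/andP; split) => //; apply/eqP;
   [apply: (N 0%Z 1%Z)|apply: (N 0%Z 2%Z)|apply: (N 0%Z 3%Z)|apply: (N 0%Z 4%Z)]; lia.
have s5 : f (row 5) \notin s.
  rewrite !inE !negb_or; do !(apply/andP; split) => //; apply/eqP => /esym;
   [apply: (N 1%Z 4%Z)|apply: (N 2%Z 3%Z)|apply: (N 3%Z 2%Z)|apply: (N 4%Z 1%Z)]; lia.
apply: contraTeq (max_card (mem [:: f (row 0), f (row 5) & s])) => f05.
by rewrite (card_uniqP _) ?card_ord //= inE negb_or f05 s0 s5.
Qed.

(** * Placing the points in the plane *)

Import Order.TTheory GRing.Theory Num.Theory.
Local Open Scope classical_set_scope.
Local Open Scope ring_scope.

Section Embedding.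

Variable R : realType.

Local Notation s3 := (Num.sqrt 3 : R).
Local Notation s11 := (Num.sqrt 11 : R).

Definition Zr (z : Z) : R := (int_of_Z z)%:~R.

Lemma ZrD a b : Zr (a + b)%Z = Zr a + Zr b.
Proof. by rewrite /Zr (rmorphD int_of_Z) rmorphD. Qed.

Lemma ZrM a b : Zr (a * b)%Z = Zr a * Zr b.
Proof. by rewrite /Zr (rmorphM int_of_Z) rmorphM. Qed.

Lemma ZrB a b : Zr (a - b)%Z = Zr a - Zr b.
Proof. by apply/(canRL (addrK _)); rewrite -ZrD; congr Zr; lia. Qed.

(** The real part of (a + b w) + (c + d w) e^(i t), where w = (1 + i sqrt 3) / 2 and sin t = sqrt 11
    / 6; [ordinate] is the imaginary part. *)
Definition abscissa (p : vec) : R :=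
  let: (a, b, c, d) := p in
  Zr a + Zr b / 2 + 5 / 6 * (Zr c + Zr d / 2) - Zr d / 12 * s3 * s11.

Definition ordinate (p : vec) : R :=
  let: (a, b, c, d) := p in
  s3 * (Zr b / 2 + 5 / 12 * Zr d) + s11 / 6 * (Zr c + Zr d / 2).

(* p is rotated by the angle with cosine u and sine v. *)
Definition place (u v : R) (p : vec) : 'rV[R]_2 :=
  \row_i if i == 0 then u * abscissa p - v * ordinate p
         else u * ordinate p + v * abscissa p.

Lemma eudistE (p q : 'rV[R]_2) :
  eudist p q = Num.sqrt ((p 0 0 - q 0 0) ^+ 2 + (p 0 1 - q 0 1) ^+ 2).
Proof.
rewrite /eudist !big_ord_recl big_ord0 addr0.
by congr (Num.sqrt ((p 0 _ - q 0 _) ^+ 2 + (p 0 _ - q 0 _) ^+ 2)); apply: val_inj.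
Qed.

Lemma sqr_s3 : s3 ^+ 2 = 3. Proof. by rewrite sqr_sqrtr. Qed.
Lemma sqr_s11 : s11 ^+ 2 = 11. Proof. by rewrite sqr_sqrtr. Qed.

Lemma abscissaB p q : abscissa (subv p q) = abscissa p - abscissa q.
Proof.
case: p q => [[[? ?] ?] ?] [[[? ?] ?] ?]; rewrite /= !ZrB; ring.
Qed.

Lemma ordinateB p q : ordinate (subv p q) = ordinate p - ordinate q.
Proof.
case: p q => [[[? ?] ?] ?] [[[? ?] ?] ?]; rewrite /= !ZrB; ring.
Qed.

Lemma short_norm p : short p ->
  abscissa p ^+ 2 + ordinate p ^+ 2 = 1 \/ abscissa p ^+ 2 + ordinate p ^+ 2 = 4.
Proof.
case: p => [[[a b] c] d]; rewrite /short; case: ifP => // /Z.eqb_eq bcad.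
have {}bcad : Zr b * Zr c = Zr a * Zr d by rewrite -!ZrM; congr Zr.
set n := (_ + _)%Z => n312.
have rn : Zr n = 3 * (abscissa (a, b, c, d) ^+ 2 + ordinate (a, b, c, d) ^+ 2).
  have -> : Zr n = 3 * (Zr a * Zr a + Zr a * Zr b + Zr b * Zr b + Zr c * Zr c + Zr c * Zr d
       + Zr d * Zr d) + 5 * (Zr a * Zr c + Zr a * Zr d + Zr b * Zr d).
    by rewrite /n !(ZrD, ZrM).
  rewrite /abscissa /ordinate.
  have := sqr_s3; have := sqr_s11; move: s3 s11 (Zr a) (Zr b) (Zr c) (Zr d) bcad.
  move=> s t a' b' c' d' bcad tt ss.
  (* The coordinates have the form A - B s t and C s + D t. Multiplying [ss] and [tt] by suitable
     cofactors, and [bcad] by s t, leaves a goal linear in the monomials. *)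
  have ssD x : s ^+ 2 * x = 3 * x by rewrite ss.
  have ttD x : t ^+ 2 * x = 11 * x by rewrite tt.
  pose B := d' / 12; pose C := b' / 2 + 5 / 12 * d'; pose D := (c' + d' / 2) / 6.
  have := ssD (t ^+ 2 * B ^+ 2 + C ^+ 2); have := ttD (3 * B ^+ 2 + D ^+ 2).
  have : s * t * (b' * c') = s * t * (a' * d') by rewrite bcad.
  rewrite /B /C /D; move: bcad; lra.
have : Zr n = 3 \/ Zr n = 12.
  by case/orP: n312 => /Z.eqb_eq ->; [left|right].
by rewrite rn => -[] ?; [left|right]; lra.
Qed.

Lemma proper_place (c : 'rV[R]_2 -> 'I_5) u v : u ^+ 2 + v ^+ 2 = 1 ->
  (forall p q, c p = c q -> eudist p q <> 1 /\ eudist p q <> 2) ->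
  proper (c \o place u v).
Proof.
move=> uv1 cP p q /short_norm pq /cP[].
rewrite eudistE !mxE /= => N1 N2.
have E : (u * abscissa p - v * ordinate p - (u * abscissa q - v * ordinate q)) ^+ 2
   + (u * ordinate p + v * abscissa p - (u * ordinate q + v * abscissa q)) ^+ 2
   = abscissa (subv q p) ^+ 2 + ordinate (subv q p) ^+ 2.
  rewrite abscissaB ordinateB -[RHS]mul1r -uv1; ring.
rewrite E in N1 N2; case: pq => pq; rewrite pq in N1 N2; first by case: N1; rewrite sqrtr1.
by case: N2; rewrite -[4](_ : 2 ^+ 2 = _) ?sqrtr_sqr ?ger0_norm //; ring.
Qed.

Lemma mono12 (c : 'rV[R]_2 -> 'I_5) :
  exists p q, c p = c q /\ (eudist p q = 1 \/ eudist p q = 2).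
Proof.
apply: contrapT => N.
have cP p q : c p = c q -> eudist p q <> 1 /\ eudist p q <> 2.
  by move=> cpq; split=> e; case: N; exists p, q; split; rewrite // e; [left|right].
have [Zr0 Zr5] : Zr 0%Z = 0 /\ Zr 5%Z = 5 by [].
(* Turning the row about the origin gives the whole circle of radius 5 the color of its center. *)
have c0 u v : u ^+ 2 + v ^+ 2 = 1 -> c 0 = c (place u v (row 5)).
  move=> uv1; rewrite -[RHS](row5 (proper_place uv1 cP)); congr c.
  by apply/rowP => i; rewrite !mxE /= Zr0 !(mul0r, mulr0, addr0, subr0) if_same.
have ss := sqr_s11.
(* On the circle of radius 5, the chord of length 1 subtends an angle of cosine
   49/50. *)
have c5 : c (place 1 0 (row 5)) = c (place (49 / 50) (3 / 50 * s11) (row 5)).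
  by rewrite -!c0 //; lra.
case: (cP _ _ c5) => + _; apply; rewrite eudistE !mxE /= Zr0 Zr5 -[RHS]sqrtr1.
by congr Num.sqrt; lra.
Qed.

End Embedding.

Theorem theorem2 (R : realType) :
  (6 <= @chi R [set 1%R; 2%R] (colorable12 R))%N /\
  (forall c : 'rV[R]_2 -> 'I_5,
     exists p q : 'rV[R]_2, c p = c q /\ (eudist p q = 1 \/ eudist p q = 2)).
Proof.
split; last exact: mono12.
have [[c cP] _] := chiP (colorable12 R).
rewrite leqNgt ltnS; apply/negP => le5.
have [p [q [cpq pq]]] := mono12 (fun x => widen_ord le5 (c x)).
by apply: (cP p q) => //; apply: val_inj; have := congr1 val cpq.
Qed.
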